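(* Assume that there is a countable transitive model of $\mathsf{ZFC}$. Then $\mathsf{IZF}$ has the de Jongh property with respect to Dummett's logic $\mathbf{LC}$, with respect to each Gabbay–de Jongh logic $\mathbf{T}_n$ ($n\geq 1$), and with respect to each logic of bounded depth $\mathbf{BD}_n$ ($n\geq 1$). That is, $\mathbf{L}(\mathsf{IZF}(\mathbf{J}))=\mathbf{J}$ for $\mathbf{J}=\mathbf{LC}$, $\mathbf{J}=\mathbf{T}_n$ and $\mathbf{J}=\mathbf{BD}_n$.
   Context: The meta-theory is classical $\mathsf{ZFC}$ (together with the existence of a countable transitive model of $\mathsf{ZFC}$). Propositional logic. Fix a countable set $\mathrm{Prop}$ of propositional variables. A propositional logic is identified with the set of formulas it proves. $\mathbf{IPC}$ and $\mathbf{CPC}$ are intuitionistic and classical propositional logic; an intermediate logic is a logic $\mathbf{J}$ with $\mathbf{IPC}\subseteq\mathbf{J}\subseteq\mathbf{CPC}$. Kripke frames. A Kripke frame is a partial order $(K,\leq)$. It is a tree if for every $v\in K$ the set $\{w\in K: w\leq v\}$ is well-ordered by $<$ and there is $r\in K$ with $r\leq v$ for all $v\in K$. A valuation on $K$ is a map $V:\mathrm{Prop}\to\mathcal{P}(K)$ such that $w\in V(p)$ and $w\leq v$ imply $v\in V(p)$. Forcing: $v\Vdash p$ iff $v\in V(p)$; $v\Vdash\phi\wedge\psi$ iff $v\Vdash\phi$ and $v\Vdash\psi$; $v\Vdash\phi\vee\psi$ iff $v\Vdash\phi$ or $v\Vdash\psi$; $v\Vdash\phi\to\psi$ iff for all $w\geq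 v$, $w\Vdash\phi$ implies $w\Vdash\psi$; $v\Vdash\bot$ never. A formula is valid in $K$ if it is forced at every node under every valuation on $K$. For a class $\mathcal{K}$ of frames, $\mathbf{L}(\mathcal{K})$ is the set of formulas valid in all frames in $\mathcal{K}$; $\mathcal{K}$ characterises $\mathbf{J}$ if $\mathbf{L}(\mathcal{K})=\mathbf{J}$. The logics. $\mathbf{LC}$ is the intermediate logic characterised by the class of finite (nonempty) linear orders (equivalently, $\mathbf{IPC}$ extended by the scheme $(p\to q)\vee(q\to p)$). $\mathbf{T}_n$ is the intermediate logic characterised by the class of finite trees in which every node is either an end-node (a maximal node) or has exactly $n$ immediate successors. $\mathbf{BD}_n$ is the intermediate logic characterised by the class of finite trees of depth $n$ (the longest chains have exactly $n$ nodes). De Jongh property. Let $\mathsf{T}$ be a theory based on intuitionistic predicate logic in a language $\mathcal{L}$. For $\sigma:\mathrm{Prop}\to\mathcal{L}^{\mathrm{sent}}$ (the $\mathcal{L}$-sentences), $\phi^\sigma$ is obtained from $\phi$ by replacing each variable $p$ by $\sigma(p)$. $\mathbf{L}(\mathsf{T})$ is the set of propositional formulas $\phi$ with $\mathsf{T}\vdash\phi^\sigma$ for all $\sigma$. $\mathsf{T}(\mathbf{J})$ is the closure of $\mathsf{T}$ under $\mathbf{J}$, i.e. $\mathsf{T}$ together with all $\phi^\sigma$ for $\phi\in\mathbf{J}$ and all $\sigma$. $\mathsf{T}$ has the de Jongh property with respect to $\mathbf{J}$ if $\mathbf{L}(\mathsf{T}(\mathbf{J}))=\mathbf{J}$. $\mathsf{IZF}$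 is the theory in intuitionistic predicate logic with equality in the language $\mathcal{L}_\in$ of set theory with axioms: Extensionality $\forall a\forall b(\forall x(x\in a\leftrightarrow x\in b)\to a=b)$; Empty set $\exists a\,\forall x\in a\,\bot$; Pairing $\forall a\forall b\exists y\forall x(x\in y\leftrightarrow(x=a\vee x=b))$; Union $\forall a\exists y\forall x(x\in y\leftrightarrow\exists u(u\in a\wedge x\in u))$; Power set $\forall a\exists y\forall x(x\in y\leftrightarrow x\subseteq a)$; Infinity $\exists a(\exists x\,x\in a\wedge\forall x\in a\,\exists y\in a\,x\in y)$; Set Induction $(\forall a(\forall x\in a\,\phi(x)\to\phi(a)))\to\forall a\,\phi(a)$ for all formulas $\phi(x)$; Separation $\forall a\exists y\forall x(x\in y\leftrightarrow(x\in a\wedge\phi(x)))$ for all formulas $\phi(x)$; Collection $\forall a(\forall x\in a\,\exists y\,\phi(x,y)\to\exists b\,\forall x\in a\,\exists y\in b\,\phi(x,y))$ for all formulas $\phi(x,y)$ in which $b$ is not free. *)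

(* Defs.v *)
From Stdlib Require Import List Relations FinFun.
Import ListNotations.

(** * Propositional logics and Kripke frames *)

Inductive pform : Type :=
| PVar (p : nat)
| PBot
| PAnd (f g : pform)
| POr (f g : pform)
| PImp (f g : pform).

(* A logic is the set of formulas it proves. *)
Definition logic := pform -> Prop.

Record frame : Type := Frame {
  node :> Type;
  le : relation node;
  le_order : order node le }.

Arguments le {f} _ _.

Definition lt {K : frame} (v w : K) : Prop := le v w /\ v <> w.

Definition valuation_on (K : frame) (V : nat -> K -> Prop) : Prop :=
  forall p w v, V p w -> le w v -> V p v.

Fixpoint forces (K : frame) (V : nat -> K -> Prop) (v : K) (f : pform) : Prop :=
  match f with
  | PVar p => V p v
  | PBot => False
  | PAnd f g => forces K V v f /\ forces K V v g
  | POr f g => forces K V v f \/ forces K V v g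
  | PImp f g => forall w, le v w -> forces K V w f -> forces K V w g
  end.

Definition valid (K : frame) (f : pform) : Prop :=
  forall V, valuation_on K V -> forall v, forces K V v f.

Definition logic_of (C : frame -> Prop) : logic :=
  fun f => forall K, C K -> valid K f.

Definition linear_order (K : frame) : Prop := forall v w : K, le v w \/ le w v.

Definition well_ordered (K : frame) (S : K -> Prop) : Prop :=
  (forall v w, S v -> S w -> lt v w \/ v = w \/ lt w v) /\
  (forall P : K -> Prop, (exists v, S v /\ P v) ->
     exists m, S m /\ P m /\ forall v, S v -> P v -> le m v).

Definition tree (K : frame) : Prop :=
  (forall v : K, well_ordered K (fun w => le w v)) /\
  (exists r : K, forall v, le r v).

Definition end_node {K : frame} (v : K) : Prop := forall w, ~ lt v w.

Definition immediate_successor {K : frame} (v w : K) : Prop :=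
  lt v w /\ ~ exists u, lt v u /\ lt u w.

Definition has_exactly {A : Type} (n : nat) (P : A -> Prop) : Prop :=
  exists l, NoDup l /\ length l = n /\ forall x, In x l <-> P x.

(* A finite chain, listed without repetition in any order. *)
Definition chain {K : frame} (l : list K) : Prop :=
  NoDup l /\ forall v w, In v l -> In w l -> le v w \/ le w v.

Definition has_depth (K : frame) (n : nat) : Prop :=
  (exists l : list K, chain l /\ length l = n) /\
  (forall l : list K, chain l -> length l <= n).

Definition LC : logic :=
  logic_of (fun K => Finite K /\ inhabited K /\ linear_order K).

Definition T_ (n : nat) : logic :=
  logic_of (fun K => Finite K /\ tree K /\
    forall v : K, end_node v \/ has_exactly n (immediate_successor v)).

Definition BD (n : nat) : logic :=
  logic_of (fun K => Finite K /\ tree K /\ has_depth K n).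

(** * First-order logic in the language of set theory

   Variables are de Bruijn indices and are the only terms, so substitution
   is renaming. *)

Inductive form : Type :=
| Mem (x y : nat)
| Eq (x y : nat)
| Bot
| And (f g : form)
| Or (f g : form)
| Imp (f g : form)
| All (f : form)
| Ex (f : form).

Definition Not (f : form) : form := Imp f Bot.
Definition Iff (f g : form) : form := And (Imp f g) (Imp g f).

(* Bounded quantifiers: the bound [a] is read outside the new binder. *)
Definition AllIn (a : nat) (f : form) : form := All (Imp (Mem 0 (S a)) f).
Definition ExIn (a : nat) (f : form) : form := Ex (And (Mem 0 (S a)) f).

Definition up (r : nat -> nat) (k : nat) : nat :=
  match k with 0 => 0 | S k => S (r k) end.

Fixpoint ren (r : nat -> nat) (f : form) : form :=
  match f with
  | Mem x y => Mem (r x) (r y)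
  | Eq x y => Eq (r x) (r y)
  | Bot => Bot
  | And f g => And (ren r f) (ren r g)
  | Or f g => Or (ren r f) (ren r g)
  | Imp f g => Imp (ren r f) (ren r g)
  | All f => All (ren (up r) f)
  | Ex f => Ex (ren (up r) f)
  end.

Definition inst (x : nat) (f : form) : form :=
  ren (fun k => match k with 0 => x | S k => k end) f.

(* All free variables of [f] are below [n]. *)
Fixpoint bounded (n : nat) (f : form) : Prop :=
  match f with
  | Mem x y | Eq x y => x < n /\ y < n
  | Bot => True
  | And f g | Or f g | Imp f g => bounded n f /\ bounded n g
  | All f | Ex f => bounded (S n) f
  end.

Definition closed (f : form) : Prop := bounded 0 f.
Definition sentence : Type := { f : form | closed f }.

Inductive deriv : list form -> form -> Prop :=
| Hyp G f : In f G -> deriv G f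
| BotE G f : deriv G Bot -> deriv G f
| AndI G f g : deriv G f -> deriv G g -> deriv G (And f g)
| AndE1 G f g : deriv G (And f g) -> deriv G f
| AndE2 G f g : deriv G (And f g) -> deriv G g
| OrI1 G f g : deriv G f -> deriv G (Or f g)
| OrI2 G f g : deriv G g -> deriv G (Or f g)
| OrE G f g h :
    deriv G (Or f g) -> deriv (f :: G) h -> deriv (g :: G) h -> deriv G h
| ImpI G f g : deriv (f :: G) g -> deriv G (Imp f g)
| ImpE G f g : deriv G (Imp f g) -> deriv G f -> deriv G g
| AllI G f : deriv (map (ren S) G) f -> deriv G (All f)
| AllE G f x : deriv G (All f) -> deriv G (inst x f)
| ExI G f x : deriv G (inst x f) -> deriv G (Ex f)
| ExE G f g :
    deriv G (Ex f) -> deriv (f :: map (ren S) G) (ren S g) -> deriv G g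
| EqI G x : deriv G (Eq x x)
| EqE G x y f : deriv G (Eq x y) -> deriv G (inst x f) -> deriv G (inst y f).

Definition theory := form -> Prop.

Definition proves (T : theory) (f : form) : Prop :=
  exists G, (forall g, In g G -> T g) /\ deriv G f.

(* The universal closures of the formulas in [A]. *)
Definition closures (A : form -> Prop) : theory :=
  fun g => closed g /\ exists k f, A f /\ g = Nat.iter k All f.

(** * Axioms of set theory

   In a schema the parameters of [f] are its remaining free variables; the
   renaming applied to [f] skips the binders that must not occur free in it. *)

Definition extensionality : form :=
  All (All (Imp (All (Iff (Mem 0 2) (Mem 0 1))) (Eq 1 0))).
Definition empty_set : form := Ex (AllIn 0 Bot).
Definition pairing : form :=
  All (All (Ex (All (Iff (Mem 0 1) (Or (Eq 0 3) (Eq 0 2)))))).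
Definition union : form :=
  All (Ex (All (Iff (Mem 0 1) (Ex (And (Mem 0 3) (Mem 1 0)))))).
Definition power_set : form :=
  All (Ex (All (Iff (Mem 0 1) (All (Imp (Mem 0 1) (Mem 0 3)))))).

(* [f] is phi(x), with x = 0. *)
Definition separation (f : form) : form :=
  All (Ex (All (Iff (Mem 0 1) (And (Mem 0 2) (ren (up S) f))))).

(* There is an inhabited set such that each element is a member of another. *)
Definition infinity : form :=
  Ex (And (Ex (Mem 0 1)) (AllIn 0 (ExIn 1 (Mem 1 0)))).

(* [f] is phi(x), with x = 0. *)
Definition set_induction (f : form) : form :=
  Imp (All (Imp (AllIn 0 (ren (up S) f)) f)) (All f).

(* [f] is phi(x,y), with y = 0 and x = 1. *)
Definition collection (f : form) : form :=
  All (Imp (AllIn 0 (Ex f)) (Ex (AllIn 1 (ExIn 1 (ren (up (up S)) f))))).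

Inductive IZF_axiom : form -> Prop :=
| IZF_extensionality : IZF_axiom extensionality
| IZF_empty_set : IZF_axiom empty_set
| IZF_pairing : IZF_axiom pairing
| IZF_union : IZF_axiom union
| IZF_power_set : IZF_axiom power_set
| IZF_infinity : IZF_axiom infinity
| IZF_set_induction f : IZF_axiom (set_induction f)
| IZF_separation f : IZF_axiom (separation f)
| IZF_collection f : IZF_axiom (collection f).

Definition IZF : theory := closures IZF_axiom.

(* Some set contains the empty set and is closed under x |-> x u {x}. *)
Definition inductive_set : form :=
  Ex (And (ExIn 0 (AllIn 0 Bot))
          (AllIn 0 (ExIn 1 (All (Iff (Mem 0 1) (Or (Mem 0 2) (Eq 0 2))))))).

Definition foundation : form :=
  All (Imp (Ex (Mem 0 1)) (ExIn 0 (AllIn 1 (Not (Mem 0 1))))).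

(* [f] is phi(x,y), with y = 0 and x = 1: if phi is functional on a, then
   { y | exists x in a, phi(x,y) } is a set. *)
Definition replacement (f : form) : form :=
  All (Imp
    (AllIn 0 (All (All (Imp (And (ren S f) (ren (up S) f)) (Eq 1 0)))))
    (Ex (All (Iff (Mem 0 1) (ExIn 2
      (ren (fun k => match k with 0 => 1 | 1 => 0 | S k => S (S k) end) f)))))).

(* Every family of nonempty, pairwise disjoint sets has a transversal. *)
Definition choice : form :=
  All (Imp
    (And (AllIn 0 (Ex (Mem 0 1)))
         (AllIn 0 (AllIn 1
           (Imp (Ex (And (Mem 0 2) (Mem 0 1))) (Eq 1 0)))))
    (Ex (AllIn 1 (Ex (All (Iff (And (Mem 0 2) (Mem 0 3)) (Eq 0 1))))))).

(* Only interpreted in classical structures below. *)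
Inductive ZFC_axiom : form -> Prop :=
| ZFC_extensionality : ZFC_axiom extensionality
| ZFC_empty_set : ZFC_axiom empty_set
| ZFC_pairing : ZFC_axiom pairing
| ZFC_union : ZFC_axiom union
| ZFC_power_set : ZFC_axiom power_set
| ZFC_infinity : ZFC_axiom inductive_set
| ZFC_foundation : ZFC_axiom foundation
| ZFC_separation f : ZFC_axiom (separation f)
| ZFC_replacement f : ZFC_axiom (replacement f)
| ZFC_choice : ZFC_axiom choice.

Definition ZFC : theory := closures ZFC_axiom.

(** * Countable transitive models

   The sets of the metatheory are Aczel's iterative sets: [sup A F] is the set
   { F a | a : A }, and equality of sets is bisimilarity. *)

Inductive iset : Type := sup (A : Type) (F : A -> iset).

Fixpoint iset_eq (x y : iset) : Prop :=
  match x, y with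
  | sup A F, sup B G =>
      (forall a, exists b, iset_eq (F a) (G b)) /\
      (forall b, exists a, iset_eq (F a) (G b))
  end.

Definition iset_mem (x y : iset) : Prop :=
  match y with sup B G => exists b, iset_eq x (G b) end.

Definition scons (a : iset) (e : nat -> iset) (k : nat) : iset :=
  match k with 0 => a | S k => e k end.

(* Tarskian satisfaction in the structure (M, membership). *)
Fixpoint sat (M : iset) (e : nat -> iset) (f : form) : Prop :=
  match f with
  | Mem x y => iset_mem (e x) (e y)
  | Eq x y => iset_eq (e x) (e y)
  | Bot => False
  | And f g => sat M e f /\ sat M e g
  | Or f g => sat M e f \/ sat M e g
  | Imp f g => sat M e f -> sat M e g
  | All f => forall a, iset_mem a M -> sat M (scons a e) f
  | Ex f => exists a, iset_mem a M /\ sat M (scons a e) f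
  end.

(* The environment is irrelevant, since the members of [T] are sentences; it is
   not required to take values in [M], so that the empty set is no model. *)
Definition models (M : iset) (T : theory) : Prop :=
  forall f, T f -> forall e, sat M e f.

Definition transitive_set (M : iset) : Prop :=
  forall x, iset_mem x M -> forall y, iset_mem y x -> iset_mem y M.

Definition countable_set (M : iset) : Prop :=
  exists s : nat -> iset, forall x, iset_mem x M -> exists n, iset_eq x (s n).

Definition countable_transitive_model (T : theory) (M : iset) : Prop :=
  countable_set M /\ transitive_set M /\ models M T.

(** * The de Jongh property *)

Fixpoint translate (s : nat -> sentence) (f : pform) : form :=
  match f with
  | PVar p => proj1_sig (s p)
  | PBot => Bot
  | PAnd f g => And (translate s f) (translate s g)
  | POr f g => Or (translate s f) (translate s g)
  | PImp f g => Imp (translate s f) (translate s g)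
  end.

Definition propositional_logic (T : theory) : logic :=
  fun f => forall s, proves T (translate s f).

Definition closure_under (T : theory) (J : logic) : theory :=
  fun g => T g \/ exists f s, J f /\ g = translate s f.

Definition de_jongh_property (T : theory) (J : logic) : Prop :=
  forall f, propositional_logic (closure_under T J) f <-> J f.

(* Main.v *)
From Stdlib Require Import List FinFun Relations Arith ZArith Lia.
From Stdlib Require Import Classical ClassicalEpsilon.
Require Import Defs.
Import ListNotations.

(** Every logic [J] of a class of finite frames is the logic of IZF(J)
    ([de_jongh_of_finite_frames]); each logic of the statement is defined by a
    class of finite frames.

    The inclusion of [J] in the logic of IZF(J) is immediate. For the converse,
    let [f] fail in a finite frame [K] of the class under a valuation [V]. It
    suffices to find a model of IZF with truth values in the upsets of a preorder
    [Q], with a map [base] from [Q] to [K], such that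
    - the truth value of every sentence is the preimage under [base] of an upset
      of [K], and [base] preserves forcing, so that all instances of [J] hold
      because [J] is valid in [K];
    - conversely, the preimage of every upset of [K] is the truth value of some
      sentence, so that [V] arises from a substitution [s] and [f^s] fails.

    For any preorder [Q], the sets-with-conditions over [Q] form a model of IZF:
    this is the Heyting-valued universe over the algebra of upsets of [Q], read
    as a Kripke model with constant domain ([IZF_sound], [deriv_sound]). An
    automorphism of [Q] acts on this universe, so that the truth value of a
    sentence is invariant under automorphisms ([holds_automorphism]).

    The preorder [Q] is obtained from [K] by replacing each node [u] by a pile of
    levels indexed by the integers, each level consisting of [2 ^ rank u]
    pairwise incomparable classes and lying entirely below the next one; the piles
    are ordered as in [K]. Here [rank] is an injection of [K] into the natural
    numbers that reverses the order. Translating all levels is an automorphism, which makes the truth value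
    of a sentence constant on each pile ([true_at_same_base]). On the other hand,
    the truth values of sentences about the subsets of a singleton depend on
    the cone above a node, and can express that it contains no antichain of size
    [N] ([width_below]). A cone that starts in the pile of [u] has antichains of
    size [2 ^ rank u], but none of size [2 ^ S (rank u)]: an antichain lies within
    one level of each pile, and the piles it meets have distinct ranks at most
    [rank u]. So these sentences recover the rank ([width_below_blow_up]). Finally the implication between two
    consecutive ones defines the complement of the down-set of a node, and every
    upset of [K] is a finite intersection of such complements
    ([definable_upset]). *)

(** * The sentences that bound the width of a cone *)

Definition disjunction (l : list form) : form := fold_right Or Bot l.

(** The truth value of this formula is an arbitrary upset when the set [i] varies;
    quantifying over sets thus amounts to quantifying over propositions. *)
Definition inhabited_var (i : nat) : form := Ex (Mem 0 (S i)).

Definition some_inhabited (l : list nat) : form :=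
  disjunction (map inhabited_var l).

(** This is the axiom of bounded width for intermediate logics, its propositional
    variables being read as above and universally quantified. *)
Definition width_below (N : nat) : form :=
  Nat.iter N All (disjunction (map
    (fun i => Imp (inhabited_var i) (some_inhabited (remove Nat.eq_dec i (seq 0 N))))
    (seq 0 N))).

Lemma bounded_iter_All n m f : bounded (n + m) f -> bounded m (Nat.iter n All f).
Proof.
  revert m; induction n as [|n IH]; simpl; intros m H; [exact H |].
  apply IH. rewrite Nat.add_succ_r. exact H.
Qed.

Lemma bounded_disjunction n l : Forall (bounded n) l -> bounded n (disjunction l).
Proof. induction 1; simpl; auto. Qed.

Lemma bounded_some_inhabited n l :
  Forall (fun i => i < n) l -> bounded n (some_inhabited l).
Proof.
  intros H. apply bounded_disjunction. rewrite Forall_map.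
  eapply Forall_impl; [| exact H]. intros i Hi. simpl in *. lia.
Qed.

Lemma width_below_closed N : closed (width_below N).
Proof.
  apply bounded_iter_All. rewrite Nat.add_0_r.
  apply bounded_disjunction. rewrite Forall_map. apply Forall_forall.
  intros i Hi. apply in_seq in Hi. split; [simpl; lia |].
  apply bounded_some_inhabited, Forall_forall. intros j Hj.
  apply in_remove in Hj. destruct Hj as [Hj _]. apply in_seq in Hj. lia.
Qed.

(** * The universe of sets over a preorder *)

Section KripkeSets.

Variables (Q : Type) (leq : relation Q).
Hypothesis leq_preorder : preorder Q leq.

Let leq_refl : forall k, leq k k := preord_refl Q leq leq_preorder.
Let leq_trans : forall j k l, leq j k -> leq k l -> leq j l :=
  preord_trans Q leq leq_preorder.

(** The set [mk A F t] receives the element [F a] at each [q] with [t a q] and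
    keeps it above; [present] takes this upward closure. *)
Inductive name : Type := mk (A : Type) (F : A -> name) (t : A -> Q -> Prop).

Definition present {A : Type} (t : A -> Q -> Prop) (a : A) (k : Q) : Prop :=
  exists q, leq q k /\ t a q.

Fixpoint eqv (x y : name) (k : Q) : Prop :=
  match x, y with
  | mk A F t, mk B G s => forall w, leq k w ->
      (forall a, present t a w -> exists b, present s b w /\ eqv (F a) (G b) w) /\
      (forall b, present s b w -> exists a, present t a w /\ eqv (F a) (G b) w)
  end.

Definition mem (x y : name) (k : Q) : Prop :=
  match y with mk B G s => exists b, present s b k /\ eqv x (G b) k end.

Definition extend (x : name) (e : nat -> name) (i : nat) : name :=
  match i with 0 => x | S i => e i end.

(** Quantifiers range over the same names at all nodes. This is correct since the
    join of a family of upsets is its union, so that an existential statement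
    holds at [k] just if it has a witness at [k]. *)
Fixpoint holds (e : nat -> name) (f : form) (k : Q) : Prop :=
  match f with
  | Mem x y => mem (e x) (e y) k
  | Eq x y => eqv (e x) (e y) k
  | Bot => False
  | And f g => holds e f k /\ holds e g k
  | Or f g => holds e f k \/ holds e g k
  | Imp f g => forall w, leq k w -> holds e f w -> holds e g w
  | All f => forall x, holds (extend x e) f k
  | Ex f => exists x, holds (extend x e) f k
  end.

Lemma present_mono {A : Type} (t : A -> Q -> Prop) a k w :
  leq k w -> present t a k -> present t a w.
Proof. intros H (q & Hq & Ht). exists q. eauto. Qed.

Lemma present_intro {A : Type} (t : A -> Q -> Prop) a k : t a k -> present t a k.
Proof. intros H. exists k. auto. Qed.

Lemma eqv_refl x k : eqv x x k.
Proof.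
  revert k; induction x as [A F IH t]; intros k w _.
  split; intros a Ha; exists a; auto.
Qed.

Lemma eqv_sym x y k : eqv x y k -> eqv y x k.
Proof.
  revert y k; induction x as [A F IH t]; intros [B G s] k H w Hw.
  destruct (H w Hw) as [H1 H2]; split.
  - intros b Hb. destruct (H2 b Hb) as (a & Ha & E). eauto.
  - intros a Ha. destruct (H1 a Ha) as (b & Hb & E). eauto.
Qed.

Lemma eqv_trans x y z k : eqv x y k -> eqv y z k -> eqv x z k.
Proof.
  revert y z k; induction x as [A F IH t]; intros [B G s] [C H r] k H1 H2 w Hw.
  destruct (H1 w Hw) as [F1 B1], (H2 w Hw) as [F2 B2]; split.
  - intros a Ha. destruct (F1 a Ha) as (b & Hb & E).
    destruct (F2 b Hb) as (c & Hc & E'). eauto.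
  - intros c Hc. destruct (B2 c Hc) as (b & Hb & E).
    destruct (B1 b Hb) as (a & Ha & E'). eauto.
Qed.

Lemma eqv_mono x y k w : leq k w -> eqv x y k -> eqv x y w.
Proof. destruct x, y; simpl; intros Hw H u Hu. apply H. eauto. Qed.

Lemma mem_mono x y k w : leq k w -> mem x y k -> mem x y w.
Proof.
  destruct y as [B G s]; intros Hw (b & Hb & E).
  exists b; split; [eapply present_mono | eapply eqv_mono]; eauto.
Qed.

Lemma mem_eqv_l x x' y k : eqv x x' k -> mem x y k -> mem x' y k.
Proof.
  destruct y as [B G s]; intros E (b & Hb & E').
  exists b; split; [exact Hb | exact (eqv_trans _ _ _ _ (eqv_sym _ _ _ E) E')].
Qed.

(** Extensionality in the universe; it also yields the congruence of membership
    in its right argument. *)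
Lemma eqv_iff_same_members x y k :
  eqv x y k <-> forall w, leq k w -> forall z, mem z x w <-> mem z y w.
Proof.
  destruct x as [A F t], y as [B G s]; split.
  - intros H w Hw z. destruct (H w Hw) as [H1 H2]. split.
    + intros (a & Ha & E). destruct (H1 a Ha) as (b & Hb & E').
      exists b; split; [exact Hb | eapply eqv_trans; eauto].
    + intros (b & Hb & E). destruct (H2 b Hb) as (a & Ha & E').
      exists a; split; [exact Ha | eapply eqv_trans; eauto using eqv_sym].
  - intros H w Hw. split.
    + intros a Ha. apply (H w Hw (F a)). exists a; split; auto using eqv_refl.
    + intros b Hb. destruct (proj2 (H w Hw (G b))) as (a & Ha & E).
      * exists b; split; auto using eqv_refl.
      * exists a; auto using eqv_sym.
Qed.

Lemma mem_congr x x' y y' k :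
  eqv x x' k -> eqv y y' k -> (mem x y k <-> mem x' y' k).
Proof.
  intros Ex Ey.
  assert (H := proj1 (eqv_iff_same_members y y' k) Ey k (leq_refl k)).
  rewrite <- H. split; apply mem_eqv_l; auto using eqv_sym.
Qed.

Lemma holds_mono f e k w : leq k w -> holds e f k -> holds e f w.
Proof.
  revert e k w; induction f; simpl; intros e k w Hw; eauto using mem_mono, eqv_mono.
  - intros [H1 H2]; eauto.
  - intros [H | H]; eauto.
  - intros [x Hx]; eauto.
Qed.

(** Renaming and replacement of parameters by equal ones are treated together,
    since the schemas need both at once. *)
Lemma holds_ren f r e e' k :
  (forall i, eqv (e (r i)) (e' i) k) -> (holds e (ren r f) k <-> holds e' f k).
Proof.
  assert (Hup : forall r e e' k, (forall i, eqv (e (r i)) (e' i) k) ->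
    forall x i, eqv (extend x e (up r i)) (extend x e' i) k).
  { intros r0 e0 e1 k0 H x [|i]; simpl; auto using eqv_refl. }
  revert r e e' k; induction f; simpl; intros r e e' k H.
  - apply mem_congr; apply H.
  - split; intros E.
    + eapply eqv_trans; [apply eqv_sym, H | eapply eqv_trans; eauto].
    + eapply eqv_trans; [apply H | eapply eqv_trans; [eauto | apply eqv_sym, H]].
  - tauto.
  - rewrite (IHf1 r e e' k H), (IHf2 r e e' k H). tauto.
  - rewrite (IHf1 r e e' k H), (IHf2 r e e' k H). tauto.
  - assert (H' : forall w, leq k w -> forall i, eqv (e (r i)) (e' i) w)
      by eauto using eqv_mono.
    split; intros I w Hw; specialize (H' w Hw); specialize (I w Hw);
      rewrite (IHf1 r e e' w H'), (IHf2 r e e' w H') in *; exact I.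
  - split; intros I x; apply (IHf _ _ _ _ (Hup r e e' k H x)), I.
  - split; intros [x I]; exists x; apply (IHf _ _ _ _ (Hup r e e' k H x)), I.
Qed.

Lemma holds_congr f e e' k :
  (forall i, eqv (e i) (e' i) k) -> (holds e f k <-> holds e' f k).
Proof.
  intros H. rewrite <- (holds_ren f (fun i => i) e e' k H).
  symmetry. apply holds_ren. intros i. apply eqv_refl.
Qed.

Lemma holds_shift f x e k : holds (extend x e) (ren S f) k <-> holds e f k.
Proof. apply holds_ren. intros i. apply eqv_refl. Qed.

Lemma holds_inst f y e k : holds e (inst y f) k <-> holds (extend (e y) e) f k.
Proof. apply holds_ren. intros [|i]; apply eqv_refl. Qed.

(** * Soundness *)

Lemma deriv_sound G f :
  deriv G f -> forall e k, (forall g, In g G -> holds e g k) -> holds e f k.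
Proof.
  assert (Hcons : forall e k f G, holds e f k -> (forall g, In g G -> holds e g k) ->
    forall g, In g (f :: G) -> holds e g k).
  { intros e k f0 G0 Hf HG g [<- | Hg]; auto. }
  assert (Hmap : forall e k x G, (forall g, In g G -> holds e g k) ->
    forall g, In g (map (ren S) G) -> holds (extend x e) g k).
  { intros e k x G0 HG g Hg. apply in_map_iff in Hg. destruct Hg as (h & <- & Hh).
    apply holds_shift; auto. }
  induction 1; intros e k HG; simpl in *.
  - auto.
  - destruct (IHderiv e k HG).
  - auto.
  - apply (IHderiv e k HG).
  - apply (IHderiv e k HG).
  - auto.
  - auto.
  - destruct (IHderiv1 e k HG) as [H' | H']; eauto.
  - intros w Hw Hf. apply IHderiv, Hcons; eauto using holds_mono.
  - eapply IHderiv1; eauto.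
  - intros x. apply IHderiv. eauto.
  - apply holds_inst, IHderiv, HG.
  - exists (e x). apply holds_inst. auto.
  - destruct (IHderiv1 e k HG) as [x Hx]. apply (holds_shift g x). eauto.
  - apply eqv_refl.
  - apply holds_inst. apply (holds_congr f (extend (e x) e)).
    + intros [|i]; simpl; auto using eqv_refl.
    + apply holds_inst. auto.
Qed.

Definition full {A : Type} (a : A) (k : Q) : Prop := True.

Definition empty : name := mk False (fun a => match a with end) full.

Lemma mem_full A F x k : mem x (mk A F full) k <-> exists a, eqv x (F a) k.
Proof.
  split; intros (a & H); exists a; [apply H | split; [|exact H]].
  apply present_intro. exact I.
Qed.

Lemma holds_AllIn e a f k :
  holds e (AllIn a f) k <->
  forall x w, leq k w -> mem x (e a) w -> holds (extend x e) f w.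
Proof. reflexivity. Qed.

Lemma holds_ExIn e a f k :
  holds e (ExIn a f) k <-> exists x, mem x (e a) k /\ holds (extend x e) f k.
Proof. reflexivity. Qed.

Lemma holds_Iff e f g k :
  holds e (Iff f g) k <-> forall w, leq k w -> (holds e f w <-> holds e g w).
Proof.
  simpl. split.
  - intros [H1 H2] w Hw. split; auto.
  - intros H. split; intros w Hw; apply H; exact Hw.
Qed.

Lemma holds_extensionality e k : holds e extensionality k.
Proof.
  intros x y w Hw H. apply eqv_iff_same_members. intros u Hu z.
  destruct (H z) as [H1 H2]. split; [apply H1 | apply H2]; exact Hu.
Qed.

Lemma holds_empty_set e k : holds e empty_set k.
Proof. exists empty. intros x w Hw H. apply mem_full in H. destruct H as [[]]. Qed.

Lemma holds_pairing e k : holds e pairing k.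
Proof.
  intros x y. exists (mk bool (fun b => if b then x else y) full).
  intros z. apply holds_Iff. intros w _. simpl. split.
  - intros ([|] & _ & E); auto.
  - intros [E | E]; [exists true | exists false];
      (split; [apply present_intro; exact I | exact E]).
Qed.

Definition index (x : name) : Type := let (A, _, _) := x in A.
Definition element (x : name) : index x -> name :=
  match x with mk A F t => F end.
Definition present_in (x : name) : index x -> Q -> Prop :=
  match x with mk A F t => present t end.

Lemma mem_iff z x k :
  mem z x k <-> exists a, present_in x a k /\ eqv z (element x a) k.
Proof. destruct x; reflexivity. Qed.

Lemma present_in_mono x a k w :
  leq k w -> present_in x a k -> present_in x a w.
Proof. destruct x; apply present_mono. Qed.

Lemma mem_element x a k : present_in x a k -> mem (element x a) x k.
Proof. intros H. apply mem_iff. exists a; split; auto using eqv_refl. Qed.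

(** Sets are built by comprehension over a family of names with monotone
    conditions; the upward closure in [present] then has no effect. *)
Lemma mem_mk A F (t : A -> Q -> Prop) z k :
  (forall a j l, leq j l -> t a j -> t a l) ->
  (mem z (mk A F t) k <-> exists a, t a k /\ eqv z (F a) k).
Proof.
  intros Ht; split; intros (a & H & E); exists a; split; auto using present_intro.
  destruct H as (q & Hq & H). eauto.
Qed.

Lemma holds_union e k : holds e union k.
Proof.
  intros x.
  exists (mk {a : index x & index (element x a)}
    (fun p => element _ (projT2 p))
    (fun p q => present_in x (projT1 p) q /\ present_in _ (projT2 p) q)).
  intros z. apply holds_Iff. intros w _.
  cbn [holds extend].
  rewrite mem_mk by (intros a j l Hl [H1 H2]; split; eauto using present_in_mono).
  split.
  - intros ([a b] & [Ha Hb] & E). simpl in *. exists (element x a). split.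
    + apply mem_element, Ha.
    + apply mem_iff. eauto.
  - intros (u & Hu & Hz). apply mem_iff in Hu. destruct Hu as (a & Ha & E).
    apply (mem_congr z z _ _ w (eqv_refl z w) E), mem_iff in Hz.
    destruct Hz as (b & Hb & E'). exists (existT _ a b). auto.
Qed.

(** Up to equality, the subsets of [x] are given by the families of conditions on
    the index type of [x], and these form a small type. *)
Lemma holds_power_set e k : holds e power_set k.
Proof.
  intros x.
  set (sub := fun D : index x -> Q -> Prop =>
    mk (index x) (element x) (fun a q => present_in x a q /\ present D a q)).
  assert (Hsub : forall D z w, mem z (sub D) w <->
    exists a, (present_in x a w /\ present D a w) /\ eqv z (element x a) w).
  { intros D z w. apply mem_mk.
    intros a j l Hl [H1 H2]; split; eauto using present_in_mono, present_mono. }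
  exists (mk (index x -> Q -> Prop) sub full).
  intros y. apply holds_Iff. intros w _. cbn [holds extend]. rewrite mem_full. split.
  - intros (D & E) z v Hv Hz.
    apply (proj1 (eqv_iff_same_members _ _ _) E v Hv), Hsub in Hz.
    destruct Hz as (a & [Ha _] & Ez). apply mem_iff. eauto.
  - intros H.
    exists (fun a q => mem (element x a) y q).
    apply eqv_iff_same_members. intros v Hv z. rewrite Hsub. split.
    + intros Hz. assert (Hx := H z v Hv Hz). simpl in Hx. apply mem_iff in Hx.
      destruct Hx as (a & Ha & E). exists a. repeat split; auto.
      apply present_intro. exact (mem_eqv_l _ _ _ _ E Hz).
    + intros (a & [_ (q & Hq & Hm)] & E).
      apply (mem_eqv_l (element x a)); eauto using eqv_sym, mem_mono.
Qed.

(** The iterated singletons of the empty set form the required set. *)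
Lemma holds_infinity e k : holds e infinity k.
Proof.
  set (num := nat_rect (fun _ => name) empty (fun _ x => mk unit (fun _ => x) full)).
  exists (mk nat num full). split.
  - exists (num 0). apply mem_full. exists 0. apply eqv_refl.
  - apply holds_AllIn. cbn [extend]. intros x w _ Hx.
    apply mem_full in Hx. destruct Hx as [n E].
    apply holds_ExIn. exists (num (S n)). split.
    + apply mem_full. exists (S n). apply eqv_refl.
    + apply mem_full. exists tt. exact E.
Qed.

Lemma holds_set_induction f e k : holds e (set_induction f) k.
Proof.
  intros w _ H x. assert (Hw := leq_refl w).
  revert Hw; generalize w at 2 3; induction x as [A F IH t]; intros v Hv.
  apply (H (mk A F t) v Hv). apply holds_AllIn. intros y u Hu Hy.
  apply (holds_ren f (up S) (extend y (extend (mk A F t) e)) (extend y e)).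
  { intros [|i]; apply eqv_refl. }
  destruct Hy as (a & _ & E).
  apply (holds_congr f (extend (F a) e)); [|apply IH; eauto].
  intros [|i]; simpl; auto using eqv_refl, eqv_sym.
Qed.

Lemma holds_separation f e k : holds e (separation f) k.
Proof.
  intros x.
  exists (mk (index x) (element x)
    (fun a q => present_in x a q /\ holds (extend (element x a) (extend x e)) f q)).
  intros z. apply holds_Iff. intros w _. cbn [holds extend].
  rewrite mem_mk
    by (intros a j l Hl [H1 H2]; split; eauto using present_in_mono, holds_mono).
  rewrite (holds_ren f _ _ (extend z (extend x e))) by (intros [|i]; apply eqv_refl).
  assert (Hf : forall a, eqv z (element x a) w ->
    holds (extend z (extend x e)) f w <-> holds (extend (element x a) (extend x e)) f w).
  { intros a E. apply holds_congr. intros [|i]; simpl; auto using eqv_refl. }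
  split.
  - intros (a & [Ha H] & E). split; [apply mem_iff; eauto | apply (Hf a E), H].
  - intros [Hz H]. apply mem_iff in Hz. destruct Hz as (a & Ha & E).
    exists a. repeat split; auto. apply (Hf a E), H.
Qed.

(** Choice in the metatheory picks one witness for each potential element and
    each node; the set of all these witnesses collects. *)
Lemma holds_collection f e k : holds e (collection f) k.
Proof.
  intros x w Hw H.
  set (P := fun (p : index x * Q) y =>
    holds (extend y (extend (element x (fst p)) (extend x e))) f (snd p)).
  set (Y := fun p => epsilon (inhabits empty) (P p)).
  exists (mk (index x * Q) Y full).
  apply holds_AllIn. cbn [extend]. intros z v Hv Hz.
  apply mem_iff in Hz. destruct Hz as (a & Ha & E).
  assert (HY : P (a, v) (Y (a, v))).
  { apply epsilon_spec. apply (H (element x a) v Hv), mem_element, Ha. }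
  apply holds_ExIn. exists (Y (a, v)). split.
  - apply mem_full. exists (a, v). apply eqv_refl.
  - eapply holds_ren; [|exact HY].
    intros [|[|i]]; simpl; auto using eqv_refl.
Qed.

Lemma holds_closure n f k :
  (forall e, holds e f k) -> forall e, holds e (Nat.iter n All f) k.
Proof. intros H. induction n; simpl; auto. Qed.

Lemma IZF_sound f e k : IZF f -> holds e f k.
Proof.
  intros (_ & n & g & Hg & ->). apply holds_closure. clear e. intros e.
  destruct Hg.
  - apply holds_extensionality.
  - apply holds_empty_set.
  - apply holds_pairing.
  - apply holds_union.
  - apply holds_power_set.
  - apply holds_infinity.
  - apply holds_set_induction.
  - apply holds_separation.
  - apply holds_collection.
Qed.

(** * Automorphisms and antichains *)

Section Automorphism.

Variables h h' : Q -> Q.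
Hypothesis h_mono : forall j k, leq j k -> leq (h j) (h k).
Hypothesis h'_mono : forall j k, leq j k -> leq (h' j) (h' k).
Hypothesis h_h' : forall k, h (h' k) = k.
Hypothesis h'_h : forall k, h' (h k) = k.

Fixpoint pull (g : Q -> Q) (x : name) : name :=
  match x with mk A F t => mk A (fun a => pull g (F a)) (fun a q => t a (g q)) end.

Lemma present_pull {A : Type} (t : A -> Q -> Prop) a k :
  present (fun a q => t a (h q)) a k <-> present t a (h k).
Proof.
  split; intros (q & Hq & Ht).
  - exists (h q). auto.
  - exists (h' q). rewrite h_h', <- (h'_h k). auto.
Qed.

Lemma eqv_pull x y k : eqv (pull h x) (pull h y) k <-> eqv x y (h k).
Proof.
  revert y k; induction x as [A F IH t]; intros [B G s] k. simpl. split.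
  - intros H w Hw. destruct (H (h' w)) as [H1 H2].
    { rewrite <- (h'_h k). auto. }
    split; [intros a Ha | intros b Hb].
    + destruct (H1 a) as (b & Hb & E); [apply present_pull; rewrite h_h'; exact Ha |].
      apply present_pull in Hb. apply IH in E. rewrite h_h' in *. eauto.
    + destruct (H2 b) as (a & Ha & E); [apply present_pull; rewrite h_h'; exact Hb |].
      apply present_pull in Ha. apply IH in E. rewrite h_h' in *. eauto.
  - intros H w Hw. destruct (H (h w) (h_mono _ _ Hw)) as [H1 H2].
    split; [intros a Ha | intros b Hb].
    + apply present_pull in Ha. destruct (H1 a Ha) as (b & Hb & E).
      exists b. split; [apply present_pull, Hb | apply IH, E].
    + apply present_pull in Hb. destruct (H2 b Hb) as (a & Ha & E).
      exists a. split; [apply present_pull, Ha | apply IH, E].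
Qed.

Lemma mem_pull x y k : mem (pull h x) (pull h y) k <-> mem x y (h k).
Proof.
  destruct y as [B G s]; simpl.
  split; intros (b & Hb & E); exists b;
    (split; [apply (present_pull s b k), Hb | apply eqv_pull, E]).
Qed.

(** So pulling back is surjective up to equality, as the quantifiers require. *)
Lemma pull_pull x k : eqv (pull h (pull h' x)) x k.
Proof.
  revert k; induction x as [A F IH t]; intros k w _. simpl.
  unfold present. split; intros a (q & Hq & Ht); exists a; (split; [exists q|]); auto;
    rewrite h'_h in *; auto.
Qed.

Lemma holds_pull f e k : holds (fun i => pull h (e i)) f k <-> holds e f (h k).
Proof.
  assert (Hext : forall f x e k,
    holds (extend (pull h x) (fun i => pull h (e i))) f k <->
    holds (fun i => pull h (extend x e i)) f k).
  { intros g x e0 k0. apply holds_congr. intros [|i]; apply eqv_refl. }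
  revert e k; induction f; simpl; intros e k.
  - apply mem_pull.
  - apply eqv_pull.
  - tauto.
  - rewrite IHf1, IHf2. tauto.
  - rewrite IHf1, IHf2. tauto.
  - split; intros H w Hw Hf.
    + rewrite <- (h_h' w) in *. apply IHf2, H, IHf1, Hf.
      rewrite <- (h'_h k). rewrite h_h' in Hw. auto.
    + apply IHf2, H, IHf1, Hf. auto.
  - split; intros H x.
    + apply IHf, Hext, H.
    + apply (holds_congr f (extend (pull h (pull h' x)) (fun i => pull h (e i)))).
      { intros [|i]; [apply pull_pull | apply eqv_refl]. }
      apply Hext, IHf, H.
  - split; intros [x H].
    + exists (pull h' x). apply IHf, Hext.
      apply (holds_congr f (extend x (fun i => pull h (e i)))); [|exact H].
      intros [|i]; [apply eqv_sym, pull_pull | apply eqv_refl].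
    + exists (pull h x). apply Hext, IHf, H.
Qed.

(** The empty set is fixed by every automorphism. Evaluating sentences with all
    variables assigned to it makes invariance hold on the nose. *)
Lemma holds_automorphism f k :
  holds (fun _ => empty) f k <-> holds (fun _ => empty) f (h k).
Proof.
  rewrite <- holds_pull. apply holds_congr. intros _ w _.
  split; intros [].
Qed.

End Automorphism.

Lemma holds_iter_All n f e k :
  holds e (Nat.iter n All f) k <->
  forall e', (forall i, e' (n + i) = e i) -> holds e' f k.
Proof.
  revert e; induction n as [|n IH]; intros e; simpl.
  - split; intros H.
    + intros e' He. apply (holds_congr f e); [|exact H].
      intros i. rewrite He. apply eqv_refl.
    + apply H. reflexivity.
  - split; intros H.
    + intros e' He. apply (proj1 (IH _) (H (e' n))).
      intros [|i]; simpl; [f_equal; lia | rewrite <- He; f_equal; lia].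
    + intros x. apply IH. intros e' He. apply H.
      intros i. rewrite <- Nat.add_succ_r. apply He.
Qed.

Lemma holds_disjunction l e k :
  holds e (disjunction l) k <-> exists f, In f l /\ holds e f k.
Proof.
  induction l as [|g l IH]; simpl.
  - split; [tauto | intros (f & [] & _)].
  - rewrite IH. split.
    + intros [H | (f & Hf & H)]; eauto.
    + intros (f & [<- | Hf] & H); eauto.
Qed.

(** For a counterexample to the width axiom, each proposition [i] has a node
    where it alone holds, and these nodes form an antichain. Conversely, the
    cones of the nodes of an antichain are propositions that refute the axiom. *)
Lemma holds_width_below N e k :
  holds e (width_below N) k <->
  ~ exists z : nat -> Q, (forall i, i < N -> leq k (z i)) /\
      forall i j, i < N -> j < N -> leq (z j) (z i) -> i = j.
Proof.
  assert (Hsome : forall l e k, holds e (some_inhabited l) k <->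
    exists j x, In j l /\ mem x (e j) k).
  { intros l e0 k0. unfold some_inhabited. rewrite holds_disjunction. split.
    - intros (f & Hf & H). apply in_map_iff in Hf. destruct Hf as (j & <- & Hj).
      destruct H as [x Hx]. eauto.
    - intros (j & x & Hj & Hx). exists (inhabited_var j).
      split; [apply in_map, Hj | exists x; exact Hx]. }
  unfold width_below. rewrite holds_iter_All. split.
  - intros H (z & Hz & Hanti).
    set (x := fun i => mk unit (fun _ => empty) (fun _ q => leq (z i) q)).
    specialize (H (fun i => if i <? N then x i else e (i - N))).
    apply holds_disjunction in H.
    2: { intros i. destruct (Nat.ltb_spec (N + i) N); [lia | f_equal; lia]. }
    destruct H as (f & Hf & H). apply in_map_iff in Hf. destruct Hf as (i & <- & Hi).
    apply in_seq in Hi. specialize (H (z i)). cbn [holds] in H.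
    rewrite Hsome in H.
    destruct H as (j & y & Hj & Hy).
    + apply Hz; lia.
    + exists empty. simpl. destruct (Nat.ltb_spec i N); [|lia].
      exists tt. split; [apply present_intro, leq_refl | apply eqv_refl].
    + apply in_remove in Hj. destruct Hj as [Hj Hij]. apply in_seq in Hj.
      destruct (Nat.ltb_spec j N); [|lia].
      destruct Hy as (_ & (q & Hq & Hzq) & _).
      apply Hij. symmetry. apply Hanti; try lia. eauto.
  - intros H e' _. apply NNPP. intros Hn. apply H.
    assert (Hz : forall i, exists z, i < N -> leq k z /\
      (exists x, mem x (e' i) z) /\
      forall j, j < N -> (exists x, mem x (e' j) z) -> i = j).
    { intros i. apply NNPP. intros Hi. apply Hn. apply holds_disjunction.
      exists (Imp (inhabited_var i) (some_inhabited (remove Nat.eq_dec i (seq 0 N)))).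
      assert (HiN : i < N).
      { apply NNPP. intros HiN. apply Hi. exists k. tauto. }
      split; [apply in_map_iff; exists i; split; [reflexivity | apply in_seq; lia] |].
      intros z Hkz Hiz. apply Hsome. apply NNPP. intros Hno. apply Hi. exists z.
      intros _. repeat split; auto.
      intros j Hj [x Hx]. apply NNPP. intros Hij. apply Hno. exists j, x.
      split; [apply in_in_remove; [auto | apply in_seq; lia] | exact Hx]. }
    exists (fun i => proj1_sig (constructive_indefinite_description _ (Hz i))).
    split.
    + intros i Hi. apply (proj2_sig (constructive_indefinite_description _ (Hz i)) Hi).
    + intros i j Hi Hj Hle.
      apply (proj2_sig (constructive_indefinite_description _ (Hz i)) Hi); [exact Hj |].
      destruct (proj2_sig (constructive_indefinite_description _ (Hz j)) Hj)
        as (_ & [x Hx] & _).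
      exists x. exact (mem_mono _ _ _ _ Hle Hx).
Qed.

End KripkeSets.

(** * Blowing up a finite frame *)

(** For [n] the rank of a node, the numbers [colour n s] stand for the classes in
    a level of its pile. They fill the interval from [2 ^ n] to [2 ^ S n], so that
    distinct ranks have disjoint sets of colours. *)
Definition colour (n s : nat) : nat := 2 ^ n + s mod 2 ^ n.

Lemma colour_bounds n s : 2 ^ n <= colour n s < 2 ^ S n.
Proof.
  unfold colour. assert (H := Nat.mod_upper_bound s (2 ^ n)).
  assert (2 ^ n <> 0) by (apply Nat.pow_nonzero; lia).
  rewrite Nat.pow_succ_r'. lia.
Qed.

(** The rank is the binary logarithm of the colour. *)
Lemma colour_inj m n s t : colour m s = colour n t -> m = n.
Proof.
  intros E.
  rewrite <- (Nat.log2_unique _ _ (Nat.le_0_l m) (colour_bounds m s)).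
  rewrite <- (Nat.log2_unique _ _ (Nat.le_0_l n) (colour_bounds n t)).
  congruence.
Qed.

Section BlowUp.

Variable K : frame.

Let K_refl : forall u : K, le u u := ord_refl K le (le_order K).
Let K_trans : forall u v w : K, le u v -> le v w -> le u w :=
  ord_trans K le (le_order K).
Let K_antisym : forall u v : K, le u v -> le v u -> u = v :=
  ord_antisym K le (le_order K).

Variable rank : K -> nat.
(** The slots of a level are all natural numbers, those of the same colour being
    equivalent in the preorder. *)
Record cell : Type := Cell { base : K; level : Z; slot : nat }.

Definition below (x y : cell) : Prop :=
  lt (base x) (base y) \/
  base x = base y /\
    ((level x < level y)%Z \/
     level x = level y /\
       colour (rank (base x)) (slot x) = colour (rank (base y)) (slot y)).

Lemma below_preorder : preorder cell below.
Proof.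
  split.
  - intros x. right. auto.
  - intros x y z [[Hxy Nxy] | [Exy Lxy]] [[Hyz Nyz] | [Eyz Lyz]].
    + left. split; [eauto |]. intros E. apply Nxy, K_antisym; [exact Hxy |].
      rewrite E. exact Hyz.
    + left. rewrite <- Eyz. split; assumption.
    + left. rewrite Exy. split; assumption.
    + right. split; [congruence | lia].
Qed.

Lemma base_mono x y : below x y -> le (base x) (base y).
Proof. intros [[H _] | [E _]]; [exact H | rewrite E; apply K_refl]. Qed.

Definition true_at (f : form) (x : cell) : Prop :=
  holds cell below (fun _ => empty cell) f x.

(** The translation that takes the level of [x] to just below that of [y]
    preserves truth at [x]; truth then persists from there to [y]. Integer levels
    are used in order that all translations be automorphisms. *)
Lemma true_at_same_base f x y : base x = base y -> true_at f x -> true_at f y.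
Proof.
  intros E H.
  set (shift := fun d z => Cell (base z) (level z + d) (slot z)).
  assert (Hmono : forall d z w, below z w -> below (shift d z) (shift d w)).
  { intros d z w [Hl | [Eb [L | [L C]]]]; [left; exact Hl | |]; right;
      (split; [exact Eb | simpl]); [left; lia | right; split; [lia | exact C]]. }
  assert (Hinv : forall d z, shift d (shift (- d)%Z z) = z).
  { intros d [u l s]. unfold shift. simpl. f_equal. lia. }
  set (d := (level y - level x - 1)%Z).
  apply (holds_mono _ _ below_preorder f _ (shift d x)).
  - right. split; [exact E |]. left. simpl. lia.
  - refine (proj1 (holds_automorphism _ _ below_preorder (shift d) (shift (- d)%Z)
      _ _ _ _ f x) H); auto.
    intros z. rewrite <- (Hinv (- d)%Z z) at 2. f_equal. f_equal. lia.
Qed.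

Definition truth (s : nat -> sentence) (p : nat) (v : K) : Prop :=
  true_at (proj1_sig (s p)) (Cell v 0 0).

Lemma valuation_truth s : valuation_on K (truth s).
Proof.
  intros p w v H Hle. destruct (classic (w = v)) as [<- | N]; [exact H |].
  eapply (holds_mono _ _ below_preorder); [| exact H].
  left. split; assumption.
Qed.

(** The projection [base] is a p-morphism: a node [v] above [base x] is the base of
    some cell above [x], namely [x] itself or any cell of the pile of [v]. *)
Lemma true_at_translate s f x :
  true_at (translate s f) x <-> forces K (truth s) (base x) f.
Proof.
  revert x; induction f as [p | | f IHf g IHg | f IHf g IHg | f IHf g IHg]; intros x.
  - split; apply true_at_same_base; reflexivity.
  - reflexivity.
  - simpl. rewrite <- IHf, <- IHg. reflexivity.
  - simpl. rewrite <- IHf, <- IHg. reflexivity.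
  - split.
    + intros H v Hv Hf. destruct (classic (base x = v)) as [<- | N].
      * apply IHg, H, IHf, Hf. right. auto.
      * apply (IHg (Cell v 0 0)), H, IHf, Hf. left. split; assumption.
    + intros H y Hy Hf. apply IHg, H, IHf, Hf. apply base_mono, Hy.
Qed.

Hypothesis rank_inj : forall u v, rank u = rank v -> u = v.
Hypothesis rank_lt : forall u v, lt u v -> rank v < rank u.

Lemma rank_le u v : le u v -> rank v <= rank u.
Proof.
  intros H. destruct (classic (u = v)) as [-> | N]; [lia |].
  apply Nat.lt_le_incl, rank_lt. split; assumption.
Qed.

(** If [rank (base x)] is at least [i], the level above [x] has enough classes for
    an antichain of size [2 ^ i]. Otherwise all cells above [x] have a colour
    between [1] and [2 ^ i - 1]. Two cells of the same colour lie in the same pile,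
    and there they are comparable whether or not their levels agree; so an
    antichain of size [2 ^ i] contradicts the pigeonhole principle. *)
Lemma width_below_blow_up i e x :
  holds cell below e (width_below (2 ^ i)) x <-> rank (base x) < i.
Proof.
  rewrite (holds_width_below _ _ below_preorder). split.
  - intros H. apply NNPP. intros Hr. apply H.
    exists (fun s => Cell (base x) (level x + 1) s). split.
    + intros s _. right. split; [reflexivity |]. left. simpl. lia.
    + intros s t Hs Ht [[_ []] | [_ [L | [_ E]]]]; [reflexivity | simpl in L; lia |].
      simpl in E. unfold colour in E.
      assert (2 ^ i <= 2 ^ rank (base x)) by (apply Nat.pow_le_mono_r; lia).
      rewrite !Nat.mod_small in E by lia. lia.
  - intros Hr (z & Hz & Hanti).
    set (c := fun s => colour (rank (base (z s))) (slot (z s))).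
    assert (Hnd : NoDup (map c (seq 0 (2 ^ i)))).
    { apply Injective_map_NoDup_in; [| apply seq_NoDup].
      intros s t Hs Ht E. apply in_seq in Hs, Ht.
      assert (Eb : base (z s) = base (z t)) by (eapply rank_inj, colour_inj, E).
      destruct (Z.lt_trichotomy (level (z s)) (level (z t))) as [L | [L | L]].
      - symmetry. apply Hanti; try lia. right. auto.
      - apply Hanti; try lia. right. auto.
      - apply Hanti; try lia. right. auto. }
    assert (Hincl : incl (map c (seq 0 (2 ^ i))) (seq 1 (2 ^ i - 1))).
    { intros d Hd. apply in_map_iff in Hd. destruct Hd as (s & <- & Hs).
      apply in_seq in Hs. apply in_seq.
      assert (Hle := rank_le _ _ (base_mono _ _ (Hz s ltac:(lia)))).
      assert (Hc := colour_bounds (rank (base (z s))) (slot (z s))).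
      assert (2 ^ S (rank (base (z s))) <= 2 ^ i) by (apply Nat.pow_le_mono_r; lia).
      assert (2 ^ rank (base (z s)) <> 0) by (apply Nat.pow_nonzero; lia).
      unfold c. lia. }
    apply NoDup_incl_length in Hincl; [| exact Hnd].
    rewrite length_map, !length_seq in Hincl.
    assert (2 ^ i <> 0) by (apply Nat.pow_nonzero; lia). lia.
Qed.

(** The implication from [width_below (2 ^ S n)] to [width_below (2 ^ n)] holds at
    [x] just if no cell above [x] has a base of rank [n]. For [n] the rank of [v],
    this says that [base x] is not below [v]. An upset [U] is the intersection of
    these conditions over all [v] outside [U]. *)
Lemma definable_upset (l : list K) (U : K -> Prop) :
  exists f, closed f /\ forall x,
    true_at f x <-> forall v, In v l -> ~ U v -> ~ le (base x) v.
Proof.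
  induction l as [| v l (f & Hf & IH)].
  - exists (Imp Bot Bot). split; [split; exact I |].
    intros x. split; [intros _ v [] | intros _ y _ H; exact H].
  - destruct (classic (U v)) as [Uv | Uv].
    + exists f. split; [exact Hf |]. intros x. rewrite IH. split; intros H w.
      * intros [<- | Hw]; [tauto | auto].
      * intros Hw. apply H. right. exact Hw.
    + exists (And f (Imp (width_below (2 ^ S (rank v))) (width_below (2 ^ rank v)))).
      split; [exact (conj Hf (conj (width_below_closed _) (width_below_closed _))) |].
      assert (Hv : forall x,
        true_at (Imp (width_below (2 ^ S (rank v))) (width_below (2 ^ rank v))) x <->
        ~ le (base x) v).
      { intros x. split.
        - intros H Hle. specialize (H (Cell v (level x + 1) 0)).
          rewrite !width_below_blow_up in H. simpl in H.
          (* Moving one level up covers the case where [base x] is [v]. *)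
          enough (rank v < rank v) by lia. apply H; [| lia].
          destruct (classic (base x = v)) as [E | N].
          + right. split; [exact E |]. left. simpl. lia.
          + left. split; assumption.
        - intros H y Hy. rewrite !width_below_blow_up. intros Hr.
          destruct (Nat.eq_dec (rank (base y)) (rank v)) as [E | N]; [| lia].
          apply rank_inj in E. destruct H. rewrite <- E. apply base_mono, Hy. }
      intros x. split.
      * intros [H1 H2] w [<- | Hw]; [intros _; apply Hv, H2 | apply IH; assumption].
      * intros H. split; [apply IH; intros w Hw; apply H; right; exact Hw |].
        apply Hv, H; [left; reflexivity | exact Uv].
Qed.

Lemma definable_valuation (V : nat -> K -> Prop) :
  Finite K -> valuation_on K V ->
  exists s, forall p v, truth s p v <-> V p v.
Proof.
  intros [l Hl] HV.
  assert (H : forall p, exists f : sentence, forall v,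
    true_at (proj1_sig f) (Cell v 0 0) <-> V p v).
  { intros p. destruct (definable_upset l (V p)) as (f & Hf & H).
    exists (exist _ f Hf). intros v. simpl. rewrite H. simpl. split.
    - intros Hv. apply NNPP. intros Nv. exact (Hv v (Hl v) Nv (K_refl v)).
    - intros Hv w _ Nw Hle. exact (Nw (HV p v w Hv Hle)). }
  exists (fun p => proj1_sig (constructive_indefinite_description _ (H p))).
  intros p. exact (proj2_sig (constructive_indefinite_description _ (H p))).
Qed.

End BlowUp.

(** * The de Jongh property *)

Lemma forces_ext (K : frame) (V W : nat -> K -> Prop) f v :
  (forall p v, V p v <-> W p v) -> (forces K V v f <-> forces K W v f).
Proof.
  intros H. revert v; induction f; simpl; intros v; [apply H | tauto | | |].
  - rewrite IHf1, IHf2. tauto.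
  - rewrite IHf1, IHf2. tauto.
  - split; intros I w Hw Hf; apply IHf2, I, IHf1, Hf; exact Hw.
Qed.

Lemma filter_length_lt {A : Type} (P R : A -> bool) (l : list A) a :
  (forall b, P b = true -> R b = true) -> In a l -> P a = false -> R a = true ->
  length (filter P l) < length (filter R l).
Proof.
  intros HPR Ha HP HR.
  assert (Hle : forall m, length (filter P m) <= length (filter R m)).
  { induction m as [| b m IH]; simpl; [lia |].
    specialize (HPR b). destruct (P b), (R b); simpl; lia. }
  destruct (in_split a l Ha) as (l1 & l2 & ->).
  rewrite !filter_app, !length_app. simpl. rewrite HP, HR. simpl.
  specialize (Hle l1) as H1. specialize (Hle l2) as H2. lia.
Qed.

(** Order the nodes by the number of nodes above them, breaking ties by their
    position in an enumeration. *)
Lemma finite_rank (K : frame) : Finite K ->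
  exists rank : K -> nat, (forall u v, rank u = rank v -> u = v) /\
    forall u v, lt u v -> rank v < rank u.
Proof.
  intros [l Hl].
  set (b := fun P : Prop => if excluded_middle_informative P then true else false).
  assert (Hb : forall P, b P = true <-> P).
  { intros P. unfold b. destruct (excluded_middle_informative P); intuition congruence. }
  set (above := fun v => length (filter (fun w => b (lt v w)) l)).
  assert (Hidx : exists idx : K -> nat, (forall v, idx v < length l) /\
    forall u v, idx u = idx v -> u = v).
  { assert (H : forall v, exists n, n < length l /\ nth_error l n = Some v).
    { intros v. destruct (In_nth_error l v (Hl v)) as [n Hn]. exists n.
      split; [apply nth_error_Some; congruence | exact Hn]. }
    exists (fun v => proj1_sig (constructive_indefinite_description _ (H v))).
    split.
    - intros v. apply (proj2_sig (constructive_indefinite_description _ (H v))).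
    - intros u v E.
      destruct (proj2_sig (constructive_indefinite_description _ (H u))) as [_ Hu].
      destruct (proj2_sig (constructive_indefinite_description _ (H v))) as [_ Hv].
      rewrite E in Hu. congruence. }
  destruct Hidx as (idx & Hlt & Hinj).
  exists (fun v => above v * length l + idx v). split.
  - intros u v E. apply Hinj.
    apply (Nat.div_mod_unique (length l) (above u) (above v)); auto. nia.
  - intros u v Huv.
    enough (above v < above u) by (specialize (Hlt v); nia).
    destruct (le_order K) as [_ K_trans K_antisym].
    apply (filter_length_lt _ _ _ v); [| apply Hl | |].
    + intros w Hw. apply (proj1 (Hb _)) in Hw. apply Hb. destruct Huv as [Huv Nuv], Hw as [Hvw _].
      split; [exact (K_trans _ _ _ Huv Hvw) |].
      intros <-. exact (Nuv (K_antisym _ _ Huv Hvw)).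
    + destruct (b (lt v v)) eqn:E; [| reflexivity].
      apply (proj1 (Hb _)) in E. destruct E as [_ []]. reflexivity.
    + apply Hb, Huv.
Qed.

Theorem de_jongh_of_finite_frames (C : frame -> Prop) :
  (forall K, C K -> Finite K) -> de_jongh_property IZF (logic_of C).
Proof.
  intros HC f. split.
  - intros Hf K CK V HV v.
    destruct (finite_rank K (HC K CK)) as (rank & Hinj & Hlt).
    destruct (definable_valuation K rank Hinj Hlt V (HC K CK) HV) as [s Hs].
    apply (forces_ext K (truth K rank s) V f v Hs).
    apply (true_at_translate K rank s f (Cell K v 0 0)).
    destruct (Hf s) as (G & HG & HD).
    apply (deriv_sound _ _ (below_preorder K rank) G _ HD).
    intros g Hg. destruct (HG g Hg) as [Hax | (j & t & Hj & ->)].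
    + apply (IZF_sound _ _ (below_preorder K rank)), Hax.
    + apply true_at_translate, Hj; [exact CK | apply valuation_truth].
  - intros Hf s. exists [translate s f]. split.
    + intros g [<- | []]. right. eauto.
    + apply Hyp. left. reflexivity.
Qed.

Theorem corollary36
  (ctm : exists M : iset, countable_transitive_model ZFC M) :
  de_jongh_property IZF LC /\
  (forall n : nat, 1 <= n -> de_jongh_property IZF (T_ n)) /\
  (forall n : nat, 1 <= n -> de_jongh_property IZF (BD n)).
Proof.
  split; [| split; intros n _]; apply de_jongh_of_finite_frames; tauto.
Qed.
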